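(* Let $A$ be a basic finite dimensional algebra over a field $k$ with complete set of orthogonal primitive idempotents $1=e_1+\cdots+e_n$. For a subset $I\subset\{1,\ldots,n\}$ let $e:=\sum_{i\in I}e_i$. Then the isomorphism $K_0(\operatorname{proj}eAe)_{\mathbb R}\simeq K_0(\operatorname{proj}A)^I_{\mathbb R}$ induced by $-\otimes_{eAe}eA$ gives an isomorphism of fans $\Sigma(eAe)\simeq\Sigma^I(A)$.
   Context: In $\mathsf{K}^{\rm b}(\operatorname{proj}A)$, a 2-term presilting complex is a complex concentrated in degrees $-1,0$ with $\operatorname{Hom}(T,T[\ell])=0$ for $\ell>0$; $\mathrm{2\text{-}psilt}A$ is the set of isomorphism classes of basic ones. $K_0(\operatorname{proj}A)_{\mathbb R}=K_0(\mathsf{K}^{\rm b}(\operatorname{proj}A))\otimes\mathbb R$. For $T=T_1\oplus\cdots\oplus T_j\in\mathrm{2\text{-}psilt}A$ with $T_i$ indecomposable, $C(T)=\{\sum a_i[T_i]\mid a_i\ge0\}$; the $g$-fan is $\Sigma(A)=\{C(T)\mid T\in\mathrm{2\text{-}psilt}A\}$. $K_0(\operatorname{proj}A)^I_{\mathbb R}:=\bigoplus_{i\in I}\mathbb R[e_iA]$ and $\Sigma^I(A):=\{\sigma\in\Sigma(A)\mid\sigma\subset K_0(\operatorname{proj}A)^I_{\mathbb R}\}$. An isomorphism of fans is a lattice isomorphism whose linear extension maps cones bijectively to cones. *)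

(* Defs.v *)
From HB Require Import structures.
From mathcomp Require Import all_boot all_order all_algebra all_field.
From mathcomp Require Import classical_sets reals.
Set Implicit Arguments. Unset Strict Implicit. Unset Printing Implicit Defensive.
Import Order.TTheory GRing.Theory Num.Theory.
Local Open Scope ring_scope.
Local Open Scope classical_set_scope.

Section AlgHyp.
Variables (F : fieldType) (A : falgType F) (iota : finType) (f : iota -> A).

Definition orth_idems : Prop :=
  forall i j, f i * f j = if i == j then f i else 0.

Definition complete_idems : Prop := \sum_i f i = 1.

Definition primitive_idem (a : A) : Prop :=
  a != 0 /\ forall x, a * x * a = x -> x * x = x -> x = 0 \/ x = a.

(* e_i A ~= e_j A as right A-modules; Hom(e_i A, e_j A) = e_j A e_i *)
Definition proj_iso (i j : iota) : Prop :=
  exists u v, f j * u * f i = u /\ f i * v * f j = v /\ v * u = f i /\ u * v = f j.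

Definition basic_idems : Prop := forall i j, proj_iso i j -> i = j.
End AlgHyp.

(* proj B, for B with complete set of primitive orthogonal idempotents f_i,
   is modelled by finite direct sums (+)_k f_{s_k} B (s : seq iota); a morphism
   (+)_l f_{s_l} B -> (+)_k f_{t_k} B is a matrix with (k,l) entry in
   f_{t_k} B f_{s_l} = Hom(f_{s_l} B, f_{t_k} B), composition = matrix product. *)
Section TwoTerm.
Variables (F : fieldType) (A : falgType F) (iota : finType) (f : iota -> A).

Definition homP (t s : seq iota) (M : 'M[A]_(size t, size s)) : bool :=
  [forall k, forall l,
     f (tnth (in_tuple t) k) * M k l * f (tnth (in_tuple s) l) == M k l].

Definition idm (s : seq iota) : 'M[A]_(size s, size s) :=
  \matrix_(k, l) (if k == l then f (tnth (in_tuple s) k) else 0).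

(* a complex P1 --d--> P0 concentrated in degrees -1, 0 *)
Record cx := Cx {
  cx1 : seq iota;
  cx0 : seq iota;
  cxd : 'M[A]_(size cx0, size cx1);
  cxdP : homP cxd }.

Definition mor (X Y : cx) : Type :=
  ('M[A]_(size (cx1 Y), size (cx1 X)) * 'M[A]_(size (cx0 Y), size (cx0 X)))%type.

Definition mcomp (X Y Z : cx) (b : mor Y Z) (a : mor X Y) : mor X Z :=
  (b.1 *m a.1, b.2 *m a.2).
Definition madd (X Y : cx) (a b : mor X Y) : mor X Y := (a.1 + b.1, a.2 + b.2).
Definition mzero (X Y : cx) : mor X Y := (0, 0).
Definition mid (X : cx) : mor X X := (idm (cx1 X), idm (cx0 X)).

Definition chainmap (X Y : cx) (u : mor X Y) : Prop :=
  homP u.1 /\ homP u.2 /\ u.2 *m cxd X = cxd Y *m u.1.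

(* homotopic morphisms (equality in K^b(proj)) *)
Definition htp (X Y : cx) (u v : mor X Y) : Prop :=
  exists h : 'M[A]_(size (cx1 Y), size (cx0 X)),
    homP h /\ u.2 - v.2 = cxd Y *m h /\ u.1 - v.1 = h *m cxd X.

Definition iszero (X : cx) : Prop := htp (mid X) (mzero X X).

Definition biprod (X Y Z : cx) : Prop :=
  exists (iY : mor Y X) (pY : mor X Y) (iZ : mor Z X) (pZ : mor X Z),
    [/\ chainmap iY, chainmap pY, chainmap iZ & chainmap pZ] /\
    [/\ htp (mcomp pY iY) (mid Y), htp (mcomp pZ iZ) (mid Z),
        htp (mcomp pY iZ) (mzero Z Y), htp (mcomp pZ iY) (mzero Y Z) &
        htp (madd (mcomp iY pY) (mcomp iZ pZ)) (mid X)].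

Definition summand (Y X : cx) : Prop := exists Z, biprod X Y Z.

Definition indec (X : cx) : Prop :=
  ~ iszero X /\ forall Y Z, biprod X Y Z -> iszero Y \/ iszero Z.

Definition basic_cx (T : cx) : Prop :=
  forall Y Z, biprod T Y Z ->
  forall X, indec X -> summand X Y -> summand X Z -> False.

(* Hom_K(T, T[1]) = 0 : every g : P1 -> P0 is null-homotopic, i.e.
   g = d x + y d with x in End(P1), y in End(P0).
   (Hom(T, T[l]) = 0 automatically for l >= 2.) *)
Definition presilting (T : cx) : Prop :=
  forall g : 'M[A]_(size (cx0 T), size (cx1 T)), homP g ->
    exists (x : 'M[A]_(size (cx1 T), size (cx1 T)))
           (y : 'M[A]_(size (cx0 T), size (cx0 T))),
      [/\ homP x, homP y & g = cxd T *m x + y *m cxd T].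

(* class [T] = [P0] - [P1] in K_0(proj) = Z^iota *)
Definition gvec (X : cx) (i : iota) : int :=
  (count_mem i (cx0 X))%:Z - (count_mem i (cx1 X))%:Z.

Variable R : realType.

Definition gcone (T : cx) : set (iota -> R) :=
  [set v | exists (m : nat) (X : 'I_m -> cx) (a : 'I_m -> R),
     [/\ forall k, indec (X k) /\ summand (X k) T,
         forall k, 0 <= a k &
         v = fun i => \sum_(k < m) a k * (gvec (X k) i)%:~R]].

Definition gfan : set (set (iota -> R)) :=
  [set s | exists T, [/\ presilting T, basic_cx T & s = gcone T]].
End TwoTerm.

(* For I a set of indices, eAe (e = sum_{i in I} e_i) has complete set of
   primitive orthogonal idempotents e_i (i in I), indexed by the finType below,
   and Hom_{eAe}(e_j eAe, e_i eAe) = e_i (eAe) e_j = e_i A e_j. *)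
Definition subidx (n : nat) (I : {set 'I_n}) : finType := {i : 'I_n | i \in I}.

Definition sub_idems (F : fieldType) (A : falgType F) (n : nat)
  (e : 'I_n -> A) (I : {set 'I_n}) : subidx I -> A := fun x => e (val x).

(* K_0(proj eAe)_R -> K_0(proj A)^I_R  ( [e_i eAe] |-> [e_i A] ) *)
Definition embedI (R : realType) (n : nat) (I : {set 'I_n})
  (v : subidx I -> R) : 'I_n -> R :=
  fun i => oapp v 0 (insub i : option (subidx I)).

Definition K0I (R : realType) (n : nat) (I : {set 'I_n}) : set ('I_n -> R) :=
  [set v | forall i, i \notin I -> v i = 0].

Arguments sub_idems [F A n] e I _.
Arguments embedI [R n] I v _.
Arguments gfan [F A iota] f [R] _.

(* Main.v *)
Require Import Defs.
From mathcomp Require Import all_boot all_order all_algebra all_field.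
From mathcomp Require Import classical_sets reals.
From mathcomp Require boolp.
From Stdlib Require Import Setoid Morphisms.
Set Implicit Arguments.
Unset Strict Implicit.
Unset Printing Implicit Defensive.
Import GRing.Theory Num.Theory.
Local Open Scope ring_scope.
Local Open Scope classical_set_scope.

(** Since [e_i eAe e_j = e_i A e_j] for [i, j] in [I], a complex over [eAe] is
    the same thing as a complex over [A] all of whose labels lie in [I], with
    the same morphisms and homotopies. Because each [e_i A e_i] is local,
    Gaussian elimination makes every two-term complex homotopy equivalent to a
    reduced one, whose differential lies in the radical; as [A] is basic, this
    does not change the [g]-vector. In each degree, a reduced homotopy retract
    of [T] has no label more often than [T] does. Hence summands of complexes
    over [eAe] come from [eAe], so that indecomposability, basicness and cones
    do not depend on the ambient algebra. Conversely, if [T] is presilting and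
    reduced, its terms in degrees [0] and [-1] share no label: otherwise some
    [e_i] would lie in the radical. Splitting [T] into indecomposables, each
    label of [T] is thus a nonzero coordinate of the [g]-vector of some
    summand, so a cone contained in [K_0^I] forces all labels into [I]. *)

Lemma map_tuple_surj (aT : finType) (rT : eqType) (g : aT -> rT) n
    (t : n.-tuple rT) :
  {subset t <= codom g} -> exists s : n.-tuple aT, t = map_tuple g s.
Proof.
move=> t_g; have /fin_all_exists [h hE] k : exists x, g x = tnth t k.
  by have /codomP [x ->] := t_g _ (mem_tnth k t); exists x.
exists (mktuple h); apply: eq_from_tnth => k.
by rewrite tnth_map tnth_mktuple hE.
Qed.

Section SingleEntry.
Variables (R : pzRingType) (m n : nat) (k : 'I_m) (l : 'I_n) (c : R).

Definition single_mx : 'M[R]_(m, n) :=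
  \matrix_(i, j) (c *+ ((i == k) && (j == l))).

Lemma mul_single_mx p (M : 'M[R]_(n, p)) i j :
  (single_mx *m M) i j = (c * M l j) *+ (i == k).
Proof.
rewrite mxE (bigD1 l) //= mxE eqxx andbT big1 => [|h /negPf hl].
  by rewrite addr0 mulrnAl.
by rewrite mxE hl andbF mul0r.
Qed.

Lemma mulmx_single p (M : 'M[R]_(p, m)) i j :
  (M *m single_mx) i j = (M i k * c) *+ (j == l).
Proof.
rewrite mxE (bigD1 k) //= mxE eqxx big1 => [|h /negPf hk].
  by rewrite addr0 mulrnAr.
by rewrite mxE hk mulr0.
Qed.

End SingleEntry.

(** * Primitive idempotents *)

Definition has_rinv (R : pzRingType) (a x : R) : Prop := exists y, x * y = a.

Lemma has_rinv_refl (R : pzRingType) (a : R) : has_rinv a a.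
Proof. by exists 1; rewrite mulr1. Qed.

Lemma has_rinvN (R : pzRingType) (a x : R) : has_rinv a (- x) -> has_rinv a x.
Proof. by case=> y xy; exists (- y); rewrite mulrN -mulNr. Qed.

Lemma has_rinv_mull (R : pzRingType) (a x y : R) :
  has_rinv a (x * y) -> has_rinv a x.
Proof. by case=> z xyz; exists (y * z); rewrite mulrA. Qed.

Section PrimitiveIdempotent.
Variables (F : fieldType) (A : falgType F).
Implicit Types a x y z : A.

Lemma fitting_exponent x : exists m, [/\ (0 < m)%N,
  exists b, x ^+ m = x ^+ m * (x ^+ m * b) &
  forall y, x ^+ m * (x ^+ m * y) = 0 -> x ^+ m * y = 0].
Proof.
pose image m := limg (amull (x ^+ m)).
have [m m_gt0 le_dim] :
    exists2 m, (0 < m)%N & (\dim (image m) <= \dim (image (m + m)))%N.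
  suff stable d : forall m, (0 < m)%N -> (\dim (image m) < d)%N ->
      exists2 m, (0 < m)%N & (\dim (image m) <= \dim (image (m + m)))%N.
    exact: (stable _ 1%N).
  elim: d => // d IHd m m_gt0 lt_d.
  have [le_dim | gt_dim] := leqP (\dim (image m)) (\dim (image (m + m))).
    by exists m.
  apply: (IHd (m + m)%N); first by rewrite addn_gt0 m_gt0.
  exact: leq_trans gt_dim lt_d.
have imageD : image (m + m)%N = (amull (x ^+ m) @: image m)%VS.
  by rewrite /image exprD amullM limg_comp.
have cap0 : (image m :&: lker (amull (x ^+ m)%R) = 0)%VS.
  apply/eqP; rewrite -dimv_eq0 -leqn0 -(leq_add2r (\dim (image (m + m)%N))).
  by rewrite {1}imageD limg_ker_dim.
exists m; split=> // [|y xxy0].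
  have : x ^+ m \in image m.
    by apply/memv_imgP; exists 1; rewrite ?memvf // lfunE /= mulr1.
  suff /eqP <- : image (m + m)%N == image m.
    rewrite imageD => /memv_imgP [_ /memv_imgP [b _ ->]].
    by rewrite !lfunE; exists b.
  by rewrite eqEdim le_dim imageD limgS ?subvf.
apply/eqP; rewrite -memv0 -cap0 memv_cap memv_ker lfunE /= xxy0 eqxx andbT.
by apply/memv_imgP; exists y; rewrite ?memvf // lfunE.
Qed.

Variable a : A.
Hypotheses (idem_a : a * a = a) (prim_a : primitive_idem a).

Lemma not_has_rinv0 : ~ has_rinv a 0.
Proof. by case: prim_a => /eqP a_neq0 _ [z]; rewrite mul0r => /esym. Qed.

(* Fitting's lemma for left multiplication by [x] on [a A]: the component of [a]
   in the stable image of [x] is an idempotent of [a A a], hence [0] or [a]. *)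
Lemma corner_has_rinv_or_nilpotent x :
  a * x * a = x -> has_rinv a x \/ exists m, x ^+ m = 0.
Proof.
move=> axa; have ax : a * x = x by rewrite -axa !mulrA idem_a.
have xa : x * a = x by rewrite -axa -!mulrA idem_a.
have [m [m_gt0 [b yb] inj_y]] := fitting_exponent x.
set y := x ^+ m in yb inj_y.
have ay : a * y = y by rewrite /y -(prednK m_gt0) exprS mulrA ax.
have ya : y * a = y by rewrite /y -(prednK m_gt0) exprSr -mulrA xa.
pose u := y * (b * a).
have yu : y * u = y by rewrite /u !mulrA -[y * y * b]mulrA -yb ya.
have uu : u * u = u.
  apply/esym/eqP; rewrite -subr_eq0; apply/eqP.
  have uB : u - u * u = y * (b * a - b * a * u) by rewrite mulrBr /u !mulrA.
  by rewrite uB; apply: inj_y; rewrite -uB mulrBr [y * (u * u)]mulrA !yu subrr.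
have aua : a * u * a = u by rewrite /u !mulrA ay -!mulrA idem_a.
have [u0|ua] := prim_a.2 u aua uu.
  by right; exists m; rewrite -/y -yu u0 mulr0.
by left; exists (x ^+ m.-1 * (b * a)); rewrite [LHS]mulrA -exprS prednK.
Qed.

Lemma has_rinvD x y : a * x = x -> a * y = y ->
  has_rinv a (x + y) -> has_rinv a x \/ has_rinv a y.
Proof.
move=> ax ay [z xyz].
have split_a : x * z * a + y * z * a = a by rewrite -!mulrDl xyz.
have [|x_rinv|[m xm0]] := @corner_has_rinv_or_nilpotent (x * z * a).
- by rewrite !mulrA ax -mulrA idem_a.
- by left; rewrite -mulrA in x_rinv; apply: has_rinv_mull x_rinv.
right; apply: (has_rinv_mull (y := z * a)).
rewrite mulrA; exists (\sum_(i < m) (x * z * a) ^+ i).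
have -> : y * z * a = - (a * (x * z * a - 1)).
  by rewrite mulrBr mulr1 !mulrA ax opprB -[X in X - _]split_a addrC addKr.
by rewrite mulNr -[X in - X]mulrA -subrX1 xm0 sub0r mulrN1 opprK.
Qed.

Lemma has_rinv_sum n (x : 'I_n -> A) : (forall k, a * x k = x k) ->
  has_rinv a (\sum_(k < n) x k) -> exists k, has_rinv a (x k).
Proof.
elim: n x => [|n IHn] x ax; first by rewrite big_ord0 => /not_has_rinv0.
rewrite big_ord_recl => /has_rinvD [||x0_rinv|sum_rinv].
- exact: ax.
- by rewrite mulr_sumr; apply: eq_bigr => k _; apply: ax.
- by exists ord0.
- by have [//|k xk] := IHn _ _ sum_rinv; exists (lift ord0 k).
Qed.

End PrimitiveIdempotent.

(** * Two-term complexes up to homotopy *)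

Section TwoTermComplexes.
Variables (F : fieldType) (A : falgType F) (iota : finType) (f : iota -> A).

Definition idem_mx n (t : n.-tuple iota) : 'M[A]_n :=
  diag_mx (\row_k f (tnth t k)).

Definition hom_mx m n (t : m.-tuple iota) (s : n.-tuple iota)
    (M : 'M[A]_(m, n)) : bool :=
  idem_mx t *m M *m idem_mx s == M.

Lemma hom_mxP m n (t : m.-tuple iota) (s : n.-tuple iota) (M : 'M[A]_(m, n)) :
  reflect (forall k l, f (tnth t k) * M k l * f (tnth s l) = M k l)
    (hom_mx t s M).
Proof.
rewrite /hom_mx /idem_mx mul_diag_mx mul_mx_diag.
by apply: (iffP eqP) => [/matrixP homM k l|homM];
  [have := homM k l | apply/matrixP=> k l]; rewrite !mxE.
Qed.

Lemma idem_mx_cat m n (t : m.-tuple iota) (s : n.-tuple iota) :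
  idem_mx (cat_tuple t s) = block_mx (idem_mx t) 0 0 (idem_mx s).
Proof.
rewrite /idem_mx -diag_mx_row; congr diag_mx; apply/rowP=> k.
rewrite !mxE; case: split_ordP => j ->; rewrite mxE.
  by rewrite tnth_lshift.
by rewrite tnth_rshift.
Qed.

Hypothesis orth_f : orth_idems f.

Lemma orth_idemK i : f i * f i = f i.
Proof. by rewrite orth_f eqxx. Qed.

Lemma idem_mxK n (t : n.-tuple iota) : idem_mx t *m idem_mx t = idem_mx t.
Proof.
by rewrite mulmx_diag; congr diag_mx; apply/rowP=> k; rewrite !mxE orth_idemK.
Qed.

Section HomMatrices.
Variables (m n : nat) (t : m.-tuple iota) (s : n.-tuple iota).
Implicit Types M N : 'M[A]_(m, n).

Lemma hom_mxl M : hom_mx t s M -> idem_mx t *m M = M.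
Proof. by move/eqP=> <-; rewrite !mulmxA idem_mxK. Qed.

Lemma hom_mxr M : hom_mx t s M -> M *m idem_mx s = M.
Proof. by move/eqP=> <-; rewrite -!mulmxA idem_mxK. Qed.

Lemma hom_mxlE M k l : hom_mx t s M -> f (tnth t k) * M k l = M k l.
Proof. by move/hom_mxP=> homM; rewrite -homM !mulrA orth_idemK. Qed.

Lemma hom_mxD M N : hom_mx t s M -> hom_mx t s N -> hom_mx t s (M + N).
Proof.
by move=> /eqP homM /eqP homN; rewrite /hom_mx mulmxDr mulmxDl homM homN.
Qed.

Lemma hom_mxN M : hom_mx t s M -> hom_mx t s (- M).
Proof. by move=> /eqP homM; rewrite /hom_mx mulmxN mulNmx homM. Qed.

Lemma hom_mxB M N : hom_mx t s M -> hom_mx t s N -> hom_mx t s (M - N).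
Proof. by move=> homM homN; apply: hom_mxD => //; apply: hom_mxN. Qed.

Lemma hom_mx_single k l c :
  f (tnth t k) * c * f (tnth s l) = c -> hom_mx t s (single_mx k l c).
Proof.
move=> fcf; apply/hom_mxP=> i j; rewrite mxE mulrnAr mulrnAl.
by have [->|_] := eqVneq i k; have [->|_] := eqVneq j l; rewrite ?fcf.
Qed.

Lemma hom_mx0 : hom_mx t s 0.
Proof. by rewrite /hom_mx mulmx0 mul0mx. Qed.

Lemma hom_mx_idem : hom_mx t t (idem_mx t).
Proof. by rewrite /hom_mx !idem_mxK. Qed.

End HomMatrices.

Lemma hom_mxM m n p (t : m.-tuple iota) (s : n.-tuple iota) (r : p.-tuple iota)
    (M : 'M[A]_(m, n)) (N : 'M[A]_(n, p)) :
  hom_mx t s M -> hom_mx s r N -> hom_mx t r (M *m N).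
Proof.
move=> homM homN.
by rewrite /hom_mx mulmxA (hom_mxl homM) -mulmxA (hom_mxr homN).
Qed.

(* As [cx], but the summands in each degree are labelled by a tuple whose length
   need not be syntactically the size of a sequence, so that direct sums and
   subcomplexes require no cast. *)
Record two_term := TwoTerm {
  rk1 : nat; rk0 : nat;
  lab1 : rk1.-tuple iota; lab0 : rk0.-tuple iota;
  diff : 'M[A]_(rk0, rk1);
  diffP : hom_mx lab0 lab1 diff }.

Record cmap (X Y : two_term) := CMap {
  comp1 : 'M[A]_(rk1 Y, rk1 X);
  comp0 : 'M[A]_(rk0 Y, rk0 X);
  comp1P : hom_mx (lab1 Y) (lab1 X) comp1;
  comp0P : hom_mx (lab0 Y) (lab0 X) comp0;
  comp_diff : comp0 *m diff X = diff Y *m comp1 }.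

Definition homotopic X Y (u v : cmap X Y) : Prop :=
  exists h : 'M[A]_(rk1 Y, rk0 X), [/\ hom_mx (lab1 Y) (lab0 X) h,
    comp0 u - comp0 v = diff Y *m h & comp1 u - comp1 v = h *m diff X].

Local Notation "u =~ v" := (homotopic u v) (at level 70).

Lemma homotopic_eq X Y (u v : cmap X Y) :
  comp1 u = comp1 v -> comp0 u = comp0 v -> u =~ v.
Proof.
by move=> eq1 eq0; exists 0; rewrite hom_mx0 eq1 eq0 !subrr mulmx0 mul0mx.
Qed.

Instance homotopic_equivalence X Y : Equivalence (@homotopic X Y).
Proof.
split=> [u|u v [h [homh eq0 eq1]]|].
- exact: homotopic_eq.
- by exists (- h); rewrite hom_mxN // mulmxN mulNmx -eq0 -eq1 !opprB.
- move=> u v w [h [homh eq0 eq1]] [h' [homh' eq0' eq1']].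
  exists (h + h'); rewrite hom_mxD // mulmxDl mulmxDr -eq0 -eq1 -eq0' -eq1'.
  by split=> //; rewrite addrA subrK.
Qed.

Lemma homotopic_refl X Y (u : cmap X Y) : u =~ u.
Proof. by reflexivity. Qed.
#[local] Hint Resolve homotopic_refl : core.

Program Definition cmap_id X : cmap X X :=
  @CMap X X (idem_mx (lab1 X)) (idem_mx (lab0 X)) _ _ _.
Next Obligation. exact: hom_mx_idem. Qed.
Next Obligation. exact: hom_mx_idem. Qed.
Next Obligation. by rewrite (hom_mxl (diffP _)) (hom_mxr (diffP _)). Qed.

Program Definition cmap_comp X Y Z (v : cmap Y Z) (u : cmap X Y) : cmap X Z :=
  @CMap X Z (comp1 v *m comp1 u) (comp0 v *m comp0 u) _ _ _.
Next Obligation. exact: hom_mxM (comp1P _) (comp1P _). Qed.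
Next Obligation. exact: hom_mxM (comp0P _) (comp0P _). Qed.
Next Obligation. by rewrite -mulmxA comp_diff !mulmxA comp_diff. Qed.

Program Definition cmap_add X Y (u v : cmap X Y) : cmap X Y :=
  @CMap X Y (comp1 u + comp1 v) (comp0 u + comp0 v) _ _ _.
Next Obligation. exact: hom_mxD (comp1P _) (comp1P _). Qed.
Next Obligation. exact: hom_mxD (comp0P _) (comp0P _). Qed.
Next Obligation. by rewrite mulmxDl mulmxDr !comp_diff. Qed.

Program Definition cmap_zero X Y : cmap X Y := @CMap X Y 0 0 _ _ _.
Next Obligation. exact: hom_mx0. Qed.
Next Obligation. exact: hom_mx0. Qed.
Next Obligation. by rewrite mul0mx mulmx0. Qed.

Local Notation "v ** u" := (cmap_comp v u) (at level 40, left associativity).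
Local Notation "u +~ v" := (cmap_add u v) (at level 50, left associativity).

Instance cmap_comp_proper X Y Z :
  Proper (@homotopic Y Z ==> @homotopic X Y ==> @homotopic X Z)
    (@cmap_comp X Y Z).
Proof.
move=> v v' [h [homh v0 v1]] u u' [k [homk u0 u1]].
exists (h *m comp0 u + comp1 v' *m k); split=> /=.
- by rewrite hom_mxD // (hom_mxM _ homk, hom_mxM homh) ?comp0P ?comp1P.
- rewrite mulmxDr !mulmxA -v0 -comp_diff -[comp0 v' *m _ *m _]mulmxA -u0.
  by rewrite mulmxBl mulmxBr addrA subrK.
- rewrite mulmxDl -!mulmxA -u1 comp_diff [h *m _]mulmxA -v1.
  by rewrite mulmxBl mulmxBr addrA subrK.
Qed.

Instance cmap_add_proper X Y :
  Proper (@homotopic X Y ==> @homotopic X Y ==> @homotopic X Y) (@cmap_add X Y).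
Proof.
move=> v v' [h [homh v0 v1]] u u' [k [homk u0 u1]].
exists (h + k); rewrite hom_mxD // mulmxDl mulmxDr -v0 -v1 -u0 -u1 /= !opprD.
by split=> //; rewrite addrACA.
Qed.

Section CmapLaws.
Variables X Y Z W : two_term.
Implicit Types (u : cmap X Y) (v : cmap Y Z) (w : cmap Z W).

Lemma ccompA u v w : w ** (v ** u) =~ w ** v ** u.
Proof. by apply: homotopic_eq; rewrite /= mulmxA. Qed.

Lemma ccomp1 u : u ** cmap_id X =~ u.
Proof.
by apply: homotopic_eq; [exact: hom_mxr (comp1P u) | exact: hom_mxr (comp0P u)].
Qed.

Lemma ccomp1l u : cmap_id Y ** u =~ u.
Proof.
by apply: homotopic_eq; [exact: hom_mxl (comp1P u) | exact: hom_mxl (comp0P u)].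
Qed.

Lemma ccomp0 v : v ** cmap_zero X Y =~ cmap_zero X Z.
Proof. by apply: homotopic_eq; rewrite /= mulmx0. Qed.

Lemma ccomp0l u : cmap_zero Y Z ** u =~ cmap_zero X Z.
Proof. by apply: homotopic_eq; rewrite /= mul0mx. Qed.

Lemma ccompDr v u u' : v ** (u +~ u') =~ v ** u +~ v ** u'.
Proof. by apply: homotopic_eq; rewrite /= mulmxDr. Qed.

Lemma ccompDl v v' u : (v +~ v') ** u =~ v ** u +~ v' ** u.
Proof. by apply: homotopic_eq; rewrite /= mulmxDl. Qed.

Lemma caddC u u' : u +~ u' =~ u' +~ u.
Proof. by apply: homotopic_eq; rewrite /= addrC. Qed.

Lemma caddA u u' u'' : u +~ (u' +~ u'') =~ u +~ u' +~ u''.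
Proof. by apply: homotopic_eq; rewrite /= addrA. Qed.

Lemma cadd0 u : u +~ cmap_zero X Y =~ u.
Proof. by apply: homotopic_eq; rewrite /= addr0. Qed.

Lemma cadd0l u : cmap_zero X Y +~ u =~ u.
Proof. by apply: homotopic_eq; rewrite /= add0r. Qed.

End CmapLaws.

Lemma ccompK X Y Z (a : cmap X Y) (b : cmap Y X) (u : cmap Z X) :
  b ** a =~ cmap_id X -> b ** (a ** u) =~ u.
Proof. by move=> ba; rewrite ccompA ba ccomp1l. Qed.

Lemma ccomp0K X Y Z W (a : cmap X Y) (b : cmap Y Z) (u : cmap W X) :
  b ** a =~ cmap_zero X Z -> b ** (a ** u) =~ cmap_zero W Z.
Proof. by move=> ba; rewrite ccompA ba ccomp0l. Qed.

Definition homotopy_retract X Y :=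
  exists (p : cmap Y X) (i : cmap X Y), p ** i =~ cmap_id X.

Definition homotopy_equiv X Y := exists (a : cmap X Y) (b : cmap Y X),
  a ** b =~ cmap_id Y /\ b ** a =~ cmap_id X.

Lemma homotopy_equiv_refl X : homotopy_equiv X X.
Proof. by exists (cmap_id X), (cmap_id X); rewrite ccomp1. Qed.

Lemma homotopy_equiv_sym X Y : homotopy_equiv X Y -> homotopy_equiv Y X.
Proof. by case=> a [b [ab ba]]; exists b, a. Qed.

Lemma homotopy_equiv_retract X Y : homotopy_equiv X Y -> homotopy_retract X Y.
Proof. by case=> a [b [_ ba]]; exists b, a. Qed.

Lemma homotopy_retract_trans X Y Z :
  homotopy_retract X Y -> homotopy_retract Y Z -> homotopy_retract X Z.
Proof.
move=> [p [i pi]] [q [j qj]]; exists (p ** q), (j ** i).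
by rewrite -!ccompA (ccompK _ qj).
Qed.

Lemma homotopy_equiv_trans X Y Z :
  homotopy_equiv X Y -> homotopy_equiv Y Z -> homotopy_equiv X Z.
Proof.
case=> a [b [ab ba]] [c [d [cd dc]]]; exists (c ** a), (b ** d).
by rewrite -!ccompA (ccompK _ ab) (ccompK _ dc).
Qed.

Definition contractible X := cmap_id X =~ cmap_zero X X.

Lemma contractible_retract X Y :
  homotopy_retract Y X -> contractible X -> contractible Y.
Proof.
move=> [p [i pi]] ctrX; rewrite /contractible -pi -(ccomp1l i).
by rewrite /contractible in ctrX; rewrite ctrX ccomp0l ccomp0.
Qed.

Definition biproduct X Y Z := exists (iY : cmap Y X) (pY : cmap X Y)
  (iZ : cmap Z X) (pZ : cmap X Z),
  [/\ pY ** iY =~ cmap_id Y, pZ ** iZ =~ cmap_id Z,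
      pY ** iZ =~ cmap_zero Z Y, pZ ** iY =~ cmap_zero Y Z &
      iY ** pY +~ iZ ** pZ =~ cmap_id X].

Lemma biproduct_sym X Y Z : biproduct X Y Z -> biproduct X Z Y.
Proof.
case=> iY [pY [iZ [pZ [YY ZZ YZ ZY XX]]]]; exists iZ, pZ, iY, pY; split=> //.
by rewrite caddC.
Qed.

Lemma biproduct_equiv X X' Y Y' Z Z' : homotopy_equiv X X' ->
  homotopy_equiv Y Y' -> homotopy_equiv Z Z' ->
  biproduct X Y Z -> biproduct X' Y' Z'.
Proof.
case=> a [a' [aa' a'a]] [b [b' [bb' b'b]]] [c [c' [cc' c'c]]].
case=> iY [pY [iZ [pZ [YY ZZ YZ ZY XX]]]].
exists (a ** iY ** b'), (b ** pY ** a'), (a ** iZ ** c'), (c ** pZ ** a').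
split; rewrite -!ccompA.
- by rewrite (ccompK _ a'a) (ccompK _ YY).
- by rewrite (ccompK _ a'a) (ccompK _ ZZ).
- by rewrite (ccompK _ a'a) (ccomp0K _ YZ) ccomp0.
- by rewrite (ccompK _ a'a) (ccomp0K _ ZY) ccomp0.
- rewrite (ccompK _ b'b) (ccompK _ c'c) -ccompDr [iY ** _]ccompA.
  by rewrite [iZ ** _]ccompA -ccompDl XX ccomp1l.
Qed.

Lemma biproduct_unique X X' Y Z :
  biproduct X Y Z -> biproduct X' Y Z -> homotopy_equiv X X'.
Proof.
case=> iY [pY [iZ [pZ [YY ZZ YZ ZY XX]]]].
case=> jY [qY [jZ [qZ [YY' ZZ' YZ' ZY' XX']]]].
exists (jY ** pY +~ jZ ** pZ), (iY ** qY +~ iZ ** qZ).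
split; rewrite !ccompDl !ccompDr -!ccompA.
- rewrite (ccompK _ YY) (ccompK _ ZZ) (ccomp0K _ YZ) (ccomp0K _ ZY).
  by rewrite !ccomp0 cadd0 cadd0l.
- rewrite (ccompK _ YY') (ccompK _ ZZ') (ccomp0K _ YZ') (ccomp0K _ ZY').
  by rewrite !ccomp0 cadd0 cadd0l.
Qed.

Lemma biproduct_assoc T Y Z X W V :
  biproduct T Y Z -> biproduct Y X W -> biproduct V W Z -> biproduct T X V.
Proof.
case=> iY [pY [iZ [pZ [YY ZZ YZ ZY TT]]]].
case=> iX [pX [iW [pW [XX WW XW WX YY']]]].
case=> jW [qW [jZ [qZ [WW' ZZ' WZ ZW VV]]]].
exists (iY ** iX), (pX ** pY), (iY ** iW ** qW +~ iZ ** qZ),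
  (jW ** pW ** pY +~ jZ ** pZ).
split; rewrite ?ccompDl !(ccompDr, =^~ ccompA).
- by rewrite (ccompK _ YY).
- rewrite (ccompK _ YY) (ccompK _ ZZ) (ccompK _ WW).
  by rewrite (ccomp0K _ YZ) (ccomp0K _ ZY) !ccomp0 cadd0 cadd0l.
- by rewrite (ccompK _ YY) (ccomp0K _ YZ) (ccomp0K _ XW) ccomp0 cadd0.
- by rewrite (ccompK _ YY) (ccomp0K _ ZY) WX !ccomp0 cadd0.
- rewrite (ccompK _ WW') (ccompK _ ZZ') (ccomp0K _ WZ) (ccomp0K _ ZW).
  rewrite !ccomp0 cadd0 cadd0l caddA -ccompDr [iX ** _]ccompA [iW ** _]ccompA.
  by rewrite -ccompDl YY' ccomp1l.
Qed.

Section DirectSum.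
Variables X Y : two_term.

Let blockE := (mulmx_block, mul_block_col, mul_row_block, mul_row_col,
  mul_col_row, mul_mx_row, mul_col_mx, mul0mx, mulmx0, addr0, add0r, idem_mxK,
  hom_mxl (diffP X), hom_mxl (diffP Y), hom_mxr (diffP X), hom_mxr (diffP Y)).

#[local] Obligation Tactic := by rewrite /= /hom_mx ?idem_mx_cat !blockE.

Program Definition direct_sum : two_term :=
  @TwoTerm _ _ (cat_tuple (lab1 X) (lab1 Y)) (cat_tuple (lab0 X) (lab0 Y))
    (block_mx (diff X) 0 0 (diff Y)) _.

Program Definition sum_inl : cmap X direct_sum := @CMap X direct_sum
  (col_mx (idem_mx (lab1 X)) 0) (col_mx (idem_mx (lab0 X)) 0) _ _ _.

Program Definition sum_inr : cmap Y direct_sum := @CMap Y direct_sum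
  (col_mx 0 (idem_mx (lab1 Y))) (col_mx 0 (idem_mx (lab0 Y))) _ _ _.

Program Definition sum_prl : cmap direct_sum X := @CMap direct_sum X
  (row_mx (idem_mx (lab1 X)) 0) (row_mx (idem_mx (lab0 X)) 0) _ _ _.

Program Definition sum_prr : cmap direct_sum Y := @CMap direct_sum Y
  (row_mx 0 (idem_mx (lab1 Y))) (row_mx 0 (idem_mx (lab0 Y))) _ _ _.

Lemma biproduct_direct_sum : biproduct direct_sum X Y.
Proof.
exists sum_inl, sum_prl, sum_inr, sum_prr.
split; apply: homotopic_eq;
  by rewrite /= ?idem_mx_cat !blockE ?add_block_mx ?blockE.
Qed.
End DirectSum.

Definition zero_complex : two_term := TwoTerm (hom_mx0 [tuple] [tuple]).

Lemma biproduct_zero X : biproduct X X zero_complex.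
Proof.
exists (cmap_id X), (cmap_id X), (cmap_zero _ X), (cmap_zero X _); split.
- exact: ccomp1.
- by apply: homotopic_eq; rewrite /= [RHS]flatmx0 ?flatmx0.
- exact: ccomp0.
- exact: ccomp0l.
- by rewrite ccomp1 ccomp0 cadd0.
Qed.

Definition is_summand Y X := exists Z, biproduct X Y Z.

Definition indecomposable X :=
  ~ contractible X /\
  forall Y Z, biproduct X Y Z -> contractible Y \/ contractible Z.

Definition basic T := forall Y Z, biproduct T Y Z ->
  forall X, indecomposable X -> is_summand X Y -> is_summand X Z -> False.

Lemma is_summand_refl X : is_summand X X.
Proof. by exists zero_complex; apply: biproduct_zero. Qed.

Lemma is_summand_trans X Y Z :
  is_summand X Y -> is_summand Y Z -> is_summand X Z.
Proof.
move=> [W YXW] [V ZYV]; exists (direct_sum W V).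
exact: biproduct_assoc ZYV YXW (biproduct_direct_sum W V).
Qed.

Lemma is_summand_retract X Y : is_summand X Y -> homotopy_retract X Y.
Proof. by case=> Z [i [p [_ [_ [pi _ _ _ _]]]]]; exists p, i. Qed.

Lemma is_summand_equiv X X' Y Y' :
  homotopy_equiv X X' -> homotopy_equiv Y Y' ->
  is_summand X Y -> is_summand X' Y'.
Proof.
move=> eqX eqY [Z YXZ]; exists Z.
by apply: biproduct_equiv YXZ => //; apply: homotopy_equiv_refl.
Qed.

Lemma indecomposable_equiv X Y :
  homotopy_equiv X Y -> indecomposable X -> indecomposable Y.
Proof.
move=> eqXY [nctrX splitX]; split=> [ctrY|V W YVW].
  apply: nctrX.
  exact: contractible_retract (homotopy_equiv_retract eqXY) ctrY.
apply: splitX; apply: biproduct_equiv YVW;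
  by [apply: homotopy_equiv_sym | apply: homotopy_equiv_refl].
Qed.

Lemma basic_equiv T T' : homotopy_equiv T T' -> basic T -> basic T'.
Proof.
move=> eqT basT Y Z TYZ; apply: basT; apply: biproduct_equiv TYZ;
  by [apply: homotopy_equiv_sym | apply: homotopy_equiv_refl].
Qed.

Definition rigid X := forall g, hom_mx (lab0 X) (lab1 X) g ->
  exists x y, [/\ hom_mx (lab1 X) (lab1 X) x, hom_mx (lab0 X) (lab0 X) y &
                  g = diff X *m x + y *m diff X].

Lemma rigid_retract X Y : homotopy_retract Y X -> rigid X -> rigid Y.
Proof.
case=> p [i [h [homh /= pi0 pi1]]] rigX g homg.
have [|x [y [homx homy gE]]] := rigX (comp0 i *m g *m comp1 p).
  exact: hom_mxM (hom_mxM (comp0P i) homg) (comp1P p).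
exists (comp1 p *m x *m comp1 i - h *m g *m (comp1 p *m comp1 i)),
       (comp0 p *m y *m comp0 i - g *m h); split.
- apply: hom_mxB; first exact: hom_mxM (hom_mxM (comp1P p) homx) (comp1P i).
  exact: hom_mxM (hom_mxM homh homg) (hom_mxM (comp1P p) (comp1P i)).
- apply: hom_mxB; first exact: hom_mxM (hom_mxM (comp0P p) homy) (comp0P i).
  exact: hom_mxM homg homh.
have pgi : comp0 p *m (comp0 i *m g *m comp1 p) *m comp1 i =
    diff Y *m (comp1 p *m x *m comp1 i) + comp0 p *m y *m comp0 i *m diff Y.
  rewrite gE mulmxDr mulmxDl !mulmxA comp_diff -!mulmxA; congr (_ + _).
  by rewrite -comp_diff.
rewrite mulmxBr mulmxBl addrACA -pgi.
rewrite !mulmxA -pi0 -[g *m h *m _]mulmxA -pi1 mulmxBl !mulmxBr !mulmxBl.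
by rewrite (hom_mxl homg) (hom_mxr homg) !mulmxA !opprB addrA !subrKC.
Qed.

(** * Gaussian elimination *)

(* [H] is a homotopy from the identity of [X] to [(e1, e0)], and this chain map
   factors through the smaller complex on [t1] and [t0]. *)
Section Deformation.
Variables (X : two_term) (H : 'M[A]_(rk1 X, rk0 X)).
Hypothesis homH : hom_mx (lab1 X) (lab0 X) H.
Variables (m n : nat) (t1 : m.-tuple iota) (t0 : n.-tuple iota).
Variables (j1 : 'M[A]_(rk1 X, m)) (q1 : 'M[A]_(m, rk1 X)).
Variables (j0 : 'M[A]_(rk0 X, n)) (q0 : 'M[A]_(n, rk0 X)).
Hypotheses (hom_j1 : hom_mx (lab1 X) t1 j1) (hom_q1 : hom_mx t1 (lab1 X) q1).
Hypotheses (hom_j0 : hom_mx (lab0 X) t0 j0) (hom_q0 : hom_mx t0 (lab0 X) q0).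

Let e1 := idem_mx (lab1 X) - H *m diff X.
Let e0 := idem_mx (lab0 X) - diff X *m H.

Hypotheses (qj1 : q1 *m j1 = idem_mx t1) (qj0 : q0 *m j0 = idem_mx t0).
Hypotheses (qH : q1 *m H = 0) (Hj : H *m j0 = 0).
Hypotheses (e1jq : e1 *m (j1 *m q1) = e1) (jqe0 : j0 *m q0 *m e0 = e0).

Let hom_e1 : hom_mx (lab1 X) (lab1 X) e1.
Proof. by apply: hom_mxB (hom_mx_idem _) (hom_mxM homH (diffP X)). Qed.

Let hom_e0 : hom_mx (lab0 X) (lab0 X) e0.
Proof. by apply: hom_mxB (hom_mx_idem _) (hom_mxM (diffP X) homH). Qed.

Let e0_diff : e0 *m diff X = diff X *m e1.
Proof.
by rewrite mulmxBl mulmxBr mulmxA (hom_mxl (diffP X)) (hom_mxr (diffP X)).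
Qed.

Let q1e1 : q1 *m e1 = q1.
Proof. by rewrite mulmxBr (hom_mxr hom_q1) mulmxA qH mul0mx subr0. Qed.

Let e0j0 : e0 *m j0 = j0.
Proof. by rewrite mulmxBl (hom_mxl hom_j0) -mulmxA Hj mulmx0 subr0. Qed.

Let core : two_term :=
  TwoTerm (hom_mxM (hom_mxM hom_q0 (hom_mxM hom_e0 (diffP X))) hom_j1).

Let project : cmap X core.
Proof.
apply: (@CMap X core q1 (q0 *m e0)) => //; first exact: hom_mxM hom_q0 hom_e0.
rewrite /= -!mulmxA; congr (_ *m _).
by rewrite [RHS]mulmxA e0_diff -(mulmxA (diff X)) e1jq.
Defined.

Let include : cmap core X.
Proof.
apply: (@CMap core X (e1 *m j1) j0) => //; first exact: hom_mxM hom_e1 hom_j1.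
by rewrite /= !mulmxA jqe0 e0_diff.
Defined.

Lemma deformation_retract :
  exists d (homd : hom_mx t0 t1 d), homotopy_equiv X (TwoTerm homd).
Proof.
exists (diff core), (diffP core), project, include; split.
  by apply: homotopic_eq; [rewrite /= mulmxA q1e1 | rewrite /= -mulmxA e0j0].
exists (- H); split; rewrite ?hom_mxN //=.
- by rewrite mulmxA jqe0 mulmxN addrC addKr.
- by rewrite -mulmxA e1jq mulNmx addrC addKr.
Qed.

End Deformation.

Section DropLabel.
Variables (n : nat) (t : n.+1.-tuple iota) (k : 'I_n.+1).

Definition drop_label : n.-tuple iota := [tuple tnth t (lift k i) | i < n].
Definition drop_incl : 'M[A]_(n.+1, n) := colsub (lift k) (idem_mx t).
Definition drop_proj : 'M[A]_(n, n.+1) := rowsub (lift k) (idem_mx t).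

Lemma hom_drop_incl : hom_mx t drop_label drop_incl.
Proof.
apply/hom_mxP=> i j; rewrite mxE tnth_mktuple.
by move/hom_mxP: (hom_mx_idem t) => ->.
Qed.

Lemma hom_drop_proj : hom_mx drop_label t drop_proj.
Proof.
apply/hom_mxP=> i j; rewrite mxE tnth_mktuple.
by move/hom_mxP: (hom_mx_idem t) => ->.
Qed.

Lemma drop_proj_incl : drop_proj *m drop_incl = idem_mx drop_label.
Proof.
rewrite mul_rowsub_mx mulmx_colsub idem_mxK; apply/matrixP=> i j.
by rewrite !mxE (inj_eq lift_inj) tnth_mktuple.
Qed.

Lemma mul_drop_incl_proj m (s : m.-tuple iota) (M : 'M[A]_(m, n.+1)) :
  hom_mx s t M -> (forall i, M i k = 0) -> M *m (drop_incl *m drop_proj) = M.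
Proof.
move=> homM Mk0.
rewrite mulmxA mulmx_colsub (hom_mxr homM) -[RHS](hom_mxr homM).
apply/matrixP=> i j; rewrite !mxE (bigD1_ord k) //= Mk0 mul0r add0r.
by apply: eq_bigr => l _; rewrite !mxE.
Qed.

Lemma drop_incl_proj_mul m (s : m.-tuple iota) (M : 'M[A]_(n.+1, m)) :
  hom_mx t s M -> (forall j, M k j = 0) -> drop_incl *m drop_proj *m M = M.
Proof.
move=> homM Mk0.
rewrite -mulmxA mul_rowsub_mx (hom_mxl homM) -[RHS](hom_mxl homM).
apply/matrixP=> i j; rewrite !mxE (bigD1_ord k) //= Mk0 mulr0 add0r.
by apply: eq_bigr => l _; rewrite !mxE.
Qed.

Lemma drop_proj_mul0 m (s : m.-tuple iota) (M : 'M[A]_(n.+1, m)) :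
  hom_mx t s M -> (forall i j, i != k -> M i j = 0) -> drop_proj *m M = 0.
Proof.
move=> homM M0; rewrite mul_rowsub_mx (hom_mxl homM); apply/matrixP=> i j.
by rewrite mxE M0 ?mxE // eq_sym neq_lift.
Qed.

Lemma mul_drop_incl0 m (s : m.-tuple iota) (M : 'M[A]_(m, n.+1)) :
  hom_mx s t M -> (forall i j, j != k -> M i j = 0) -> M *m drop_incl = 0.
Proof.
move=> homM M0; rewrite mulmx_colsub (hom_mxr homM); apply/matrixP=> i j.
by rewrite mxE M0 ?mxE // eq_sym neq_lift.
Qed.

Lemma count_drop_label i :
  count_mem i t = ((tnth t k == i) + count_mem i drop_label)%N.
Proof.
rewrite -!sum1_count !big_tuple big_mkcond (bigD1_ord k) //= [in RHS]big_mkcond.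
by congr (_ + _)%N; apply: eq_bigr => j _; rewrite tnth_mktuple.
Qed.

End DropLabel.

Lemma gauss_elimination m n (t0 : m.+1.-tuple iota) (t1 : n.+1.-tuple iota)
    (d : 'M[A]_(m.+1, n.+1)) (homd : hom_mx t0 t1 d) k l c :
    f (tnth t1 l) * c * f (tnth t0 k) = c ->
    d k l * c = f (tnth t0 k) -> c * d k l = f (tnth t1 l) ->
  exists d' (homd' : hom_mx (drop_label t0 k) (drop_label t1 l) d'),
    homotopy_equiv (TwoTerm homd) (TwoTerm homd').
Proof.
move=> homc dc cd.
pose H := single_mx l k c; have homH : hom_mx t1 t0 H by apply: hom_mx_single.
have home1 := hom_mxB (hom_mx_idem t1) (hom_mxM homH homd).
have home0 := hom_mxB (hom_mx_idem t0) (hom_mxM homd homH).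
apply: (@deformation_retract (TwoTerm homd) H homH _ _ _ _
  (drop_incl t1 l) (drop_proj t1 l) (drop_incl t0 k) (drop_proj t0 k)) => /=;
  rewrite ?hom_drop_incl ?hom_drop_proj ?drop_proj_incl //.
- by apply: drop_proj_mul0 homH _ => i j /negPf il; rewrite mxE il.
- by apply: mul_drop_incl0 homH _ => i j /negPf jk; rewrite mxE jk andbF.
- apply: mul_drop_incl_proj home1 _ => i.
  rewrite mxE [X in _ + X]mxE mul_single_mx cd !mxE.
  by have [->|_] := eqVneq i l; rewrite subrr.
- apply: drop_incl_proj_mul home0 _ => j.
  rewrite mxE [X in _ + X]mxE mulmx_single dc !mxE.
  by have [->|_] := eqVneq k j; rewrite subrr.
Qed.

(** * Reduced complexes *)

Hypotheses (prim_f : forall i, primitive_idem (f i)) (basic_f : basic_idems f).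

Lemma has_rinv_iso i j x : f i * x * f j = x -> has_rinv (f i) x ->
  j = i /\ exists z, [/\ f i * z * f i = z, x * z = f i & z * x = f i].
Proof.
move=> fxf [y xy]; pose z := f j * y * f i.
have xf : x * f j = x by rewrite -fxf -!mulrA orth_idemK.
have fx : f i * x = x by rewrite -fxf !mulrA orth_idemK.
have xz : x * z = f i by rewrite /z !mulrA xf xy orth_idemK.
have fz : f j * z = z by rewrite /z !mulrA orth_idemK.
have zf : z * f i = z by rewrite /z -!mulrA orth_idemK.
have zx : z * x = f j.
  have [_ /(_ (z * x)) []//] := prim_f j.
  - by rewrite mulrA fz -mulrA xf.
  - by rewrite mulrA -[z * x * z]mulrA xz zf.
  move=> zx0; have [/eqP fi_neq0 _] := prim_f i; case: fi_neq0.
  have -> : f i = x * (z * x) * z by rewrite mulrA -mulrA xz orth_idemK.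
  by rewrite zx0 mulr0 mul0r.
have ij : i = j by apply: basic_f; exists z, x; rewrite fz zf fx xf.
by subst j; split=> //; exists z; rewrite fz zf.
Qed.

Lemma has_rinv_mulr i j l c x : f i * c * f j = c -> f j * x * f l = x ->
  has_rinv (f i) (c * x) -> has_rinv (f j) x.
Proof.
move=> fcf fxf cx_rinv.
have [ji [c' [fc'f _ c'c]]] := has_rinv_iso fcf (has_rinv_mull cx_rinv).
case: cx_rinv => y cxy; exists (y * c); subst j.
have fx : f i * x = x by rewrite -fxf !mulrA orth_idemK.
have fc : f i * c = c by rewrite -fcf !mulrA orth_idemK.
have -> : x * (y * c) = c' * (c * x * y) * c by rewrite !mulrA c'c fx.
by rewrite cxy -mulrA fc.
Qed.

(* The radical of the category of projectives: as [f] is primitive and basic,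
   the morphisms [f j A -> f i A] outside it are the right invertible ones,
   which are isomorphisms and force [i = j]. *)
Definition radical_mx m n (t : m.-tuple iota) (M : 'M[A]_(m, n)) : Prop :=
  forall k l, ~ has_rinv (f (tnth t k)) (M k l).

Section RadicalMatrices.
Variables (m n : nat) (t : m.-tuple iota) (s : n.-tuple iota).
Implicit Types M N : 'M[A]_(m, n).

Lemma radical_mxD M N : hom_mx t s M -> hom_mx t s N ->
  radical_mx t M -> radical_mx t N -> radical_mx t (M + N).
Proof.
move=> homM homN radM radN k l; rewrite mxE.
by case/(has_rinvD (orth_idemK _) (prim_f _)) => [||/radM|/radN];
  rewrite ?(hom_mxlE _ _ homM) ?(hom_mxlE _ _ homN).
Qed.

Lemma radical_mxN M : radical_mx t M -> radical_mx t (- M).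
Proof. by move=> radM k l; rewrite mxE => /has_rinvN/radM. Qed.

Lemma radical_mx_mulr p M (N : 'M[A]_(n, p)) :
  hom_mx t s M -> radical_mx t M -> radical_mx t (M *m N).
Proof.
move=> homM radM k l; rewrite mxE.
case/(has_rinv_sum (orth_idemK _) (prim_f _)) => [j|j /has_rinv_mull/radM//].
by rewrite mulrA (hom_mxlE _ _ homM).
Qed.

Lemma radical_mx_mull p (r : p.-tuple iota) M (N : 'M[A]_(n, p)) :
  hom_mx t s M -> hom_mx s r N -> radical_mx s N -> radical_mx t (M *m N).
Proof.
move=> homM homN radN k l; rewrite mxE.
case/(has_rinv_sum (orth_idemK _) (prim_f _)) => [j|j].
  by rewrite mulrA (hom_mxlE _ _ homM).
move/hom_mxP in homM; move/hom_mxP in homN.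
by move/(has_rinv_mulr (homM k j) (homN j l))/radN.
Qed.

Lemma radical_idem_mx : radical_mx t (idem_mx t) -> m = 0%N.
Proof.
case: m t => // m' t' /(_ ord0 ord0); rewrite !mxE eqxx; case.
exact: has_rinv_refl.
Qed.

End RadicalMatrices.

Definition reduced X := radical_mx (lab0 X) (diff X).

Definition labels X : seq iota := lab0 X ++ lab1 X.

Definition g_vector X i : int :=
  (count_mem i (lab0 X))%:Z - (count_mem i (lab1 X))%:Z.

Lemma reduced_equiv_exists X :
  exists Y, [/\ homotopy_equiv X Y, reduced Y & g_vector X =1 g_vector Y].
Proof.
have [m] := ubnP (rk0 X); elim: m X => // m IHm X; rewrite ltnS => leX.
have [redX|] := boolp.pselect (reduced X).
  by exists X; split=> //; apply: homotopy_equiv_refl.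
move/boolp.existsNP => [k /boolp.existsNP [l /boolp.contrapT]].
case: X k l leX => b a t1 t0 d homd /= k l leX.
case: a t0 d homd k leX => [|a] t0 d homd k leX; first by case: k.
case: b t1 d homd l => [|b] t1 d homd l; first by case: l.
move=> d_rinv; have fdf : f (tnth t0 k) * d k l * f (tnth t1 l) = d k l.
  exact/hom_mxP.
have [t10 [c [fcf dc cd]]] := has_rinv_iso fdf d_rinv.
have [|//||d' [homd' equiv_d']] := @gauss_elimination _ _ _ _ _ homd k l c.
- by rewrite t10.
- by rewrite cd t10.
have [Y [equivY redY gY]] := IHm (TwoTerm homd') leX.
exists Y; split=> //; first exact: homotopy_equiv_trans equiv_d' equivY.
move=> i; rewrite -gY /g_vector /=.
rewrite (count_drop_label t0 k) (count_drop_label t1 l).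
by rewrite t10 !PoszD opprD addrACA subrr add0r.
Qed.

(* Regard [p] as a complex and replace it by a reduced one: being split
   epimorphic modulo the radical, the latter has no term in degree [0]. *)
Lemma split_mod_radical_count_leq m n (t : m.-tuple iota) (s : n.-tuple iota)
    (p : 'M[A]_(m, n)) (q : 'M[A]_(n, m)) i :
  hom_mx t s p -> hom_mx s t q -> radical_mx t (p *m q - idem_mx t) ->
  (count_mem i t <= count_mem i s)%N.
Proof.
move=> homp homq; set r := _ - _ => rad_r.
have homr : hom_mx t t r by rewrite hom_mxB ?hom_mx_idem // (hom_mxM homp).
have [Y [[a [b [[h [homh /= ab0 _]] _]]] redY /(_ i)]] :=
  reduced_equiv_exists (TwoTerm homp).
rewrite /g_vector /= => g_p; suff rk0Y : rk0 Y = 0%N.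
  have lab0Y : lab0 Y = [::] :> seq iota by apply: size0nil; rewrite size_tuple.
  by rewrite -lez_nat -subr_le0 g_p lab0Y sub0r oppr_le0.
have homa := comp0P a; have homb := comp0P b; rewrite /= in homa homb.
have home : hom_mx (lab1 Y) (lab0 Y) (comp1 a *m q *m comp0 b - h).
  by rewrite hom_mxB // (hom_mxM _ homb) // (hom_mxM (comp1P a)).
apply: (@radical_idem_mx _ (lab0 Y)).
have -> : idem_mx (lab0 Y) =
    diff Y *m (comp1 a *m q *m comp0 b - h) - comp0 a *m r *m comp0 b.
  rewrite mulmxBr -ab0 !mulmxA -comp_diff /= /r.
  rewrite mulmxBr mulmxBl (hom_mxr homa) !mulmxA !opprB.
  by rewrite [X in X + _]addrC -addrA subrKC subrK.
apply: radical_mxD.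
- exact: hom_mxM (diffP Y) home.
- exact: hom_mxN (hom_mxM (hom_mxM homa homr) homb).
- exact: radical_mx_mulr (diffP Y) redY.
- apply: radical_mxN; apply: radical_mx_mulr (hom_mxM homa homr) _.
  exact: radical_mx_mull homa homr rad_r.
Qed.

Lemma retract_count_leq X Y i : reduced X -> homotopy_retract X Y ->
  (count_mem i (lab0 X) <= count_mem i (lab0 Y))%N /\
  (count_mem i (lab1 X) <= count_mem i (lab1 Y))%N.
Proof.
move=> redX [p [j [h [homh /= pj0 pj1]]]]; split.
- apply: split_mod_radical_count_leq (comp0P p) (comp0P j) _; rewrite pj0.
  exact: radical_mx_mulr (diffP X) redX.
- apply: split_mod_radical_count_leq (comp1P p) (comp1P j) _; rewrite pj1.
  exact: radical_mx_mull homh (diffP X) redX.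
Qed.

Lemma retract_labels X Y :
  reduced X -> homotopy_retract X Y -> {subset labels X <= labels Y}.
Proof.
move=> redX rXY i; rewrite !mem_cat -!has_pred1 !has_count.
have [le_lab0 le_lab1] := retract_count_leq i redX rXY.
by case/orP => gt0; apply/orP; [left | right]; apply: leq_trans gt0 _.
Qed.

Lemma reduced_equiv_perm X Y : reduced X -> reduced Y -> homotopy_equiv X Y ->
  perm_eq (lab0 X) (lab0 Y) /\ perm_eq (lab1 X) (lab1 Y).
Proof.
move=> redX redY eqXY; have rXY := homotopy_equiv_retract eqXY.
have rYX := homotopy_equiv_retract (homotopy_equiv_sym eqXY).
have count_eq i : count_mem i (lab0 X) = count_mem i (lab0 Y) /\
                  count_mem i (lab1 X) = count_mem i (lab1 Y).
  have [le_lab0 le_lab1] := retract_count_leq i redX rXY.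
  have [ge_lab0 ge_lab1] := retract_count_leq i redY rYX.
  by split; apply/eqP; rewrite eqn_leq ?le_lab0 ?le_lab1.
by split; apply/allP=> i _ /=; apply/eqP; case: (count_eq i).
Qed.

Lemma g_vector_equiv X Y : homotopy_equiv X Y -> g_vector X =1 g_vector Y.
Proof.
move=> eqXY i.
have [X' [eqX redX' ->]] := reduced_equiv_exists X.
have [Y' [eqY redY' ->]] := reduced_equiv_exists Y.
have [|/permP perm0 /permP perm1] := reduced_equiv_perm redX' redY'.
  apply: homotopy_equiv_trans (homotopy_equiv_sym eqX) _.
  exact: homotopy_equiv_trans eqXY eqY.
by rewrite /g_vector perm0 perm1.
Qed.

Lemma contractible_labels X : labels X = [::] -> contractible X.
Proof.
move/eqP; rewrite -size_eq0 size_cat !size_tuple addn_eq0.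
case: X => n1 n0 t1 t0 d homd /= /andP[/eqP n0_0 /eqP n1_0]; subst n1 n0.
by apply: homotopic_eq; rewrite /= [LHS]flatmx0.
Qed.

Lemma reduced_contractible_labels X :
  reduced X -> contractible X -> labels X = [::].
Proof.
move=> redX [h [homh /=]]; rewrite !subr0 => id0 id1.
apply: size0nil; rewrite size_cat !size_tuple.
rewrite (radical_idem_mx (t := lab0 X)) ?(radical_idem_mx (t := lab1 X)) //.
  by rewrite id1; apply: radical_mx_mull homh (diffP X) redX.
by rewrite id0; apply: radical_mx_mulr (diffP X) redX.
Qed.

Lemma reduced_direct_sum X Y :
  reduced X -> reduced Y -> reduced (direct_sum X Y).
Proof.
move=> redX redY k l /=; case: (split_ordP k) (split_ordP l) => i -> [] j ->;
  rewrite ?tnth_lshift ?tnth_rshift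
    ?block_mxEul ?block_mxEur ?block_mxEdl ?block_mxEdr ?mxE;
  by [apply: redX | apply: redY | apply: not_has_rinv0].
Qed.

Lemma labels_direct_sum X Y :
  perm_eq (labels (direct_sum X Y)) (labels X ++ labels Y).
Proof. by rewrite /labels /= perm_catACA. Qed.

Lemma biproduct_labels X Y Z : reduced X -> reduced Y -> reduced Z ->
  biproduct X Y Z -> perm_eq (labels X) (labels Y ++ labels Z).
Proof.
move=> redX redY redZ XYZ; apply: perm_trans (labels_direct_sum Y Z).
have eqX := biproduct_unique XYZ (biproduct_direct_sum Y Z).
have [] := reduced_equiv_perm redX (reduced_direct_sum redY redZ) eqX.
exact: perm_cat.
Qed.

Lemma decomposable_reduced X : reduced X -> ~ contractible X ->
  ~ indecomposable X -> exists Y Z,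
    [/\ biproduct X Y Z, reduced Y, reduced Z,
        labels Y != [::] & labels Z != [::]].
Proof.
move=> redX nctrX /boolp.not_andP [//|/boolp.existsNP [Y /boolp.existsNP [Z]]].
move/boolp.not_implyP => [XYZ /boolp.not_orP [nctrY nctrZ]].
have nonempty V W : homotopy_equiv V W -> ~ contractible V -> labels W != [::].
  move=> eqVW nctrV; apply/eqP => /contractible_labels ctrW; apply: nctrV.
  by apply: contractible_retract ctrW; apply: homotopy_equiv_retract.
have [Y' [eqY redY' _]] := reduced_equiv_exists Y.
have [Z' [eqZ redZ' _]] := reduced_equiv_exists Z.
exists Y', Z'; split=> //; [|exact: nonempty nctrY|exact: nonempty nctrZ].
exact: biproduct_equiv (homotopy_equiv_refl X) eqY eqZ XYZ.
Qed.

Lemma indecomposable_summand_label X i : reduced X -> i \in labels X ->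
  exists Y, [/\ indecomposable Y, is_summand Y X, reduced Y & i \in labels Y].
Proof.
have [m] := ubnP (size (labels X)); elim: m X => // m IHm X.
rewrite ltnS => leX redX iX.
have [indX|decX] := boolp.pselect (indecomposable X).
  by exists X; split=> //; apply: is_summand_refl.
have [|Y [Z [XYZ redY redZ Y_neq0 Z_neq0]]] := decomposable_reduced redX _ decX.
  by move/(reduced_contractible_labels redX) => X0; rewrite X0 in iX.
have in_summand W V : biproduct X W V -> reduced W ->
    (size (labels W) < m)%N -> i \in labels W ->
    exists Y, [/\ indecomposable Y, is_summand Y X, reduced Y & i \in labels Y].
  move=> XWV redW ltW iW; have [U [indU UW redU iU]] := IHm W ltW redW iW.
  by exists U; split=> //; apply: is_summand_trans UW _; exists V.
have perm_YZ := biproduct_labels redX redY redZ XYZ.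
move: leX iX; rewrite (perm_size perm_YZ) (perm_mem perm_YZ) size_cat mem_cat.
rewrite -size_eq0 -lt0n in Y_neq0; rewrite -size_eq0 -lt0n in Z_neq0.
move=> leYZ /orP[].
- apply: in_summand XYZ redY _; apply: leq_trans leYZ.
  by rewrite -[X in (X < _)%N]addn0 ltn_add2l.
- apply: in_summand (biproduct_sym XYZ) redZ _; apply: leq_trans leYZ.
  by rewrite -[X in (X < _)%N]add0n ltn_add2r.
Qed.

Lemma rigid_lab_disjoint X i : reduced X -> rigid X ->
  i \in lab0 X -> i \notin lab1 X.
Proof.
move=> redX rigX /tnthP [k ik]; apply/negP => /tnthP [l il].
pose g := single_mx k l (f i).
have [|x [y [homx homy gE]]] := rigX g.
  by apply: hom_mx_single; rewrite -ik -il !orth_idemK.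
have rad_g : radical_mx (lab0 X) g.
  rewrite gE; apply: radical_mxD.
  - exact: hom_mxM (diffP X) homx.
  - exact: hom_mxM homy (diffP X).
  - exact: radical_mx_mulr (diffP X) redX.
  - exact: radical_mx_mull homy (diffP X) redX.
by case: (rad_g k l); rewrite mxE !eqxx -ik; apply: has_rinv_refl.
Qed.

Lemma rigid_g_vector_neq0 X i : reduced X -> rigid X ->
  i \in labels X -> g_vector X i != 0.
Proof.
move=> redX rigX iX; rewrite subr_eq0 eqz_nat.
have [i0|i0] := boolP (i \in lab0 X).
  rewrite (count_memPn (rigid_lab_disjoint redX rigX i0)).
  by apply: contraL i0 => /eqP/count_memPn.
rewrite eq_sym (count_memPn i0); apply: contraNN i0 => /eqP/count_memPn i1.
by move: iX; rewrite mem_cat (negPf i1) orbF.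
Qed.

(** * Cones and fans *)

Section Cones.
Variable R : realType.

Definition cone T : set (iota -> R) :=
  [set v | exists (m : nat) (X : 'I_m -> two_term) (a : 'I_m -> R),
     [/\ forall k, indecomposable (X k) /\ is_summand (X k) T,
         forall k, 0 <= a k &
         v = fun i => \sum_(k < m) a k * (g_vector (X k) i)%:~R]].

Definition fan_on (D : {pred iota}) : set (set (iota -> R)) :=
  [set s | exists T,
     [/\ {subset labels T <= D}, rigid T, basic T & s = cone T]].

Lemma cone_equiv T T' : homotopy_equiv T T' -> cone T = cone T'.
Proof.
move=> eqT; rewrite boolp.predeqE => v.
by split=> -[m [X [a [XP a_ge0 vE]]]]; exists m, X, a; split=> // k;
  have [indX sumX] := XP k; split=> //; apply: is_summand_equiv sumX;
  by [apply: homotopy_equiv_refl | exact: eqT | apply: homotopy_equiv_sym].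
Qed.

Lemma cone_supported (D : {pred iota}) T v i :
  {subset labels T <= D} -> cone T v -> i \notin D -> v i = 0.
Proof.
move=> TD [m [X [a [XP _ ->]]]] iD; apply: big1 => k _.
have [Y [eqY redY ->]] := reduced_equiv_exists (X k).
have rYT : homotopy_retract Y T.
  apply: homotopy_retract_trans (is_summand_retract (XP k).2).
  exact: homotopy_equiv_retract (homotopy_equiv_sym eqY).
have : i \notin labels Y by apply: contra iD => /(retract_labels redY rYT)/TD.
rewrite mem_cat negb_or /g_vector => /andP[/count_memPn -> /count_memPn ->].
by rewrite subrr mulr0.
Qed.

Lemma cone_label_neq0 T i : reduced T -> rigid T -> i \in labels T ->
  exists2 v, cone T v & v i != 0.
Proof.
move=> redT rigT iT.
have [Y [indY sumY redY iY]] := indecomposable_summand_label redT iT.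
exists (fun j => (g_vector Y j)%:~R).
  exists 1%N, (fun=> Y), (fun=> 1); split=> //.
  by apply: boolp.funext => j; rewrite big_ord1 mul1r.
rewrite intr_eq0; apply: rigid_g_vector_neq0 redY _ iY.
exact: rigid_retract (is_summand_retract sumY) rigT.
Qed.

Lemma fan_on_supportedP (D : {pred iota}) s :
  fan_on D s <->
  fan_on predT s /\ forall v, s v -> forall i, i \notin D -> v i = 0.
Proof.
split=> [[T [TD rigT basT ->]]|[[T [_ rigT basT ->]] coneD]].
  by split=> [|v vT i]; [exists T | apply: cone_supported TD vT].
have [T' [eqT redT' _]] := reduced_equiv_exists T.
have rigT' : rigid T'.
  by apply: rigid_retract rigT; apply/homotopy_equiv_retract/homotopy_equiv_sym.
exists T'; split=> //; [|exact: basic_equiv basT | exact: cone_equiv].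
move=> i /(cone_label_neq0 redT' rigT') [v]; rewrite -(cone_equiv eqT).
by move/coneD => vD; apply: contraR => /vD ->.
Qed.

End Cones.

Arguments cone R T : clear implicits.
Arguments fan_on R D : clear implicits.

(** * Complexes over a subset of the idempotents *)

Section Relabelling.
Variables (kappa : finType) (g : kappa -> iota).
Local Notation fg := (fun x => f (g x)).
Local Notation relabel s := (map_tuple g (in_tuple s)).

Lemma homP_relabel (t s : seq kappa) (M : 'M[A]_(size t, size s)) :
  homP fg M = hom_mx (relabel t) (relabel s) M.
Proof.
apply/idP/hom_mxP => [/forallP homM k l|homM].
  by have /forallP/(_ l)/eqP := homM k; rewrite !tnth_map.
apply/forallP=> k; apply/forallP=> l.
by have := homM k l; rewrite !tnth_map => ->.
Qed.

Lemma cxd_relabel (X : cx fg) :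
  hom_mx (relabel (cx0 X)) (relabel (cx1 X)) (cxd X).
Proof. by rewrite -homP_relabel cxdP. Qed.

Definition of_cx (X : cx fg) : two_term := TwoTerm (cxd_relabel X).

Lemma labels_of_cx X : {subset labels (of_cx X) <= codom g}.
Proof.
by move=> i; rewrite /labels /= -map_cat => /mapP [x _ ->]; apply: codom_f.
Qed.

Lemma of_cx_surj X : {subset labels X <= codom g} -> exists X', of_cx X' = X.
Proof.
case: X => n1 n0 t1 t0 d homd /= lab_g.
have [|s1 t1E] := @map_tuple_surj _ _ g _ t1.
  by move=> i i1; apply: lab_g; rewrite mem_cat i1 orbT.
have [|s0 t0E] := @map_tuple_surj _ _ g _ t0.
  by move=> i i0; apply: lab_g; rewrite mem_cat i0.
subst t1 t0; case: s1 s0 d homd {lab_g} => [s1 sz1] [s0 sz0].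
have n1E := eqP sz1; have n0E := eqP sz0; subst n1 n0.
rewrite (bool_irrelevance sz0 (eqxx _)) (bool_irrelevance sz1 (eqxx _)).
move=> d homd.
have homPd : homP fg d by rewrite homP_relabel.
by exists (Cx homPd); congr TwoTerm; apply: bool_irrelevance.
Qed.

Definition to_mor X Y (u : cmap (of_cx X) (of_cx Y)) : mor X Y :=
  (comp1 u, comp0 u).

Lemma chainmap_to_mor X Y (u : cmap (of_cx X) (of_cx Y)) : chainmap (to_mor u).
Proof.
split; first by rewrite homP_relabel; apply: comp1P u.
by split; [rewrite homP_relabel; apply: comp0P u | apply: comp_diff u].
Qed.

Lemma chainmap_to_morP X Y (u : mor X Y) : chainmap u ->
  exists v : cmap (of_cx X) (of_cx Y), u = to_mor v.
Proof.
case: u => u1 u0; rewrite /chainmap !homP_relabel => -[hom1 [hom0 ud]].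
by exists (@CMap (of_cx X) (of_cx Y) u1 u0 hom1 hom0 ud).
Qed.

Lemma mid_to_mor X : mid X = to_mor (cmap_id (of_cx X)).
Proof.
by congr pair; apply/matrixP=> k l; rewrite !mxE tnth_map; case: eqP => [->|].
Qed.

Lemma mzero_to_mor X Y : mzero X Y = to_mor (cmap_zero (of_cx X) (of_cx Y)).
Proof. by []. Qed.

Lemma mcomp_to_mor X Y Z (v : cmap (of_cx Y) (of_cx Z))
    (u : cmap (of_cx X) (of_cx Y)) :
  mcomp (to_mor v) (to_mor u) = to_mor (v ** u).
Proof. by []. Qed.

Lemma madd_to_mor X Y (u v : cmap (of_cx X) (of_cx Y)) :
  madd (to_mor u) (to_mor v) = to_mor (u +~ v).
Proof. by []. Qed.

Let to_morE := (mid_to_mor, mzero_to_mor, mcomp_to_mor, madd_to_mor).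

Lemma htpE X Y (u v : cmap (of_cx X) (of_cx Y)) :
  htp (to_mor u) (to_mor v) <-> u =~ v.
Proof.
by split=> [[h [homh [uv0 uv1]]]|[h [homh uv0 uv1]]]; exists h;
  move: homh; rewrite homP_relabel.
Qed.

Lemma iszeroE X : iszero X <-> contractible (of_cx X).
Proof. by rewrite /iszero !to_morE; apply: htpE. Qed.

Lemma biprodE X Y Z : biprod X Y Z <-> biproduct (of_cx X) (of_cx Y) (of_cx Z).
Proof.
split=> [[iY [pY [iZ [pZ [[]]]]]]|[jY [qY [jZ [qZ [YY ZZ YZ ZY XX]]]]]].
  move=> /chainmap_to_morP [jY ->] /chainmap_to_morP [qY ->].
  move=> /chainmap_to_morP [jZ ->] /chainmap_to_morP [qZ ->].
  rewrite !to_morE => -[YY ZZ YZ ZY XX]; exists jY, qY, jZ, qZ.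
  by split; apply/htpE.
exists (to_mor jY), (to_mor qY), (to_mor jZ), (to_mor qZ); rewrite !to_morE.
by split; split; by [apply: chainmap_to_mor | apply/htpE].
Qed.

Lemma presiltingE X : presilting X <-> rigid (of_cx X).
Proof.
by split=> presX h; [rewrite -homP_relabel | rewrite homP_relabel];
  move=> /presX [x [y [homx homy hE]]]; exists x, y; move: homx homy;
  rewrite !homP_relabel.
Qed.

Lemma retract_of_cx Y X : homotopy_retract Y (of_cx X) ->
  exists Y', homotopy_equiv Y (of_cx Y').
Proof.
move=> rYX; have [Z [eqZ redZ _]] := reduced_equiv_exists Y.
have rZX : homotopy_retract Z (of_cx X).
  apply: homotopy_retract_trans rYX.
  exact: homotopy_equiv_retract (homotopy_equiv_sym eqZ).
have [|Y' Y'Z] := @of_cx_surj Z; last by exists Y'; rewrite Y'Z.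
by move=> i /(retract_labels redZ rZX)/labels_of_cx.
Qed.

Lemma biproduct_of_cx X Y Z : biproduct (of_cx X) Y Z -> exists Y' Z',
  [/\ homotopy_equiv Y (of_cx Y'), homotopy_equiv Z (of_cx Z') &
      biprod X Y' Z'].
Proof.
move=> XYZ.
have [|Y' eqY] := @retract_of_cx Y X.
  by apply: is_summand_retract; exists Z.
have [|Z' eqZ] := @retract_of_cx Z X.
  by apply: is_summand_retract; exists Y; apply: biproduct_sym.
exists Y', Z'; split=> //; apply/biprodE.
exact: biproduct_equiv (homotopy_equiv_refl _) eqY eqZ XYZ.
Qed.

Lemma summandE Y X : summand Y X <-> is_summand (of_cx Y) (of_cx X).
Proof.
split=> [[Z /biprodE XYZ]|[Z XYZ]]; first by exists (of_cx Z).
have [|Z' eqZ] := @retract_of_cx Z X.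
  by apply: is_summand_retract; exists (of_cx Y); apply: biproduct_sym.
exists Z'; apply/biprodE.
exact: biproduct_equiv (homotopy_equiv_refl _) (homotopy_equiv_refl _) eqZ XYZ.
Qed.

Lemma indecE X : indec X <-> indecomposable (of_cx X).
Proof.
split=> -[nzX splitX]; split; try by move/iszeroE.
  move=> Y Z /biproduct_of_cx [Y' [Z' [eqY eqZ /splitX zYZ]]].
  by case: zYZ => /iszeroE ctr; [left | right]; apply: contractible_retract ctr;
    apply: homotopy_equiv_retract.
by move=> Y Z /biprodE /splitX [] /iszeroE; [left | right].
Qed.

Lemma basic_cxE T : basic_cx T <-> basic (of_cx T).
Proof.
split=> basT Y Z; last first.
  move/biprodE/basT => noX X /indecE indX /summandE XY /summandE; exact: noX XY.
move/biproduct_of_cx => [Y' [Z' [eqY eqZ TYZ]]] X indX XY XZ.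
have [|X' eqX] := @retract_of_cx X Y'.
  exact: is_summand_retract (is_summand_equiv (homotopy_equiv_refl X) eqY XY).
apply: (basT _ _ TYZ X').
- by apply/indecE; apply: indecomposable_equiv indX.
- by apply/summandE; apply: is_summand_equiv XY.
- by apply/summandE; apply: is_summand_equiv XZ.
Qed.

Variable R : realType.
Hypothesis inj_g : injective g.

Lemma gvecE X x : gvec X x = g_vector (of_cx X) (g x).
Proof.
rewrite /g_vector /gvec /= !count_map.
by congr (_%:Z - _%:Z); apply: eq_count => y /=; rewrite (inj_eq inj_g).
Qed.

Lemma gconeE T : gcone T = (fun v : iota -> R => v \o g) @` cone R (of_cx T).
Proof.
rewrite boolp.predeqE => v; split=> [[m [X [a [XP a_ge0 ->]]]]|].
  exists (fun i => \sum_(k < m) a k * (g_vector (of_cx (X k)) i)%:~R).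
    exists m, (fun k => of_cx (X k)), a; split=> // k.
    by have [/indecE indX /summandE sumX] := XP k.
  by apply: boolp.funext => x /=; apply: eq_bigr => k _; rewrite gvecE.
move=> [_ [m [X [a [XP a_ge0 ->]]]] <-].
have /fin_all_exists [X' eqX] k := retract_of_cx (is_summand_retract (XP k).2).
exists m, X', a; split=> // [k|].
  have [indX sumX] := XP k; split.
    by apply/indecE; apply: indecomposable_equiv indX.
  apply/summandE; exact: is_summand_equiv (eqX k) (homotopy_equiv_refl _) sumX.
apply: boolp.funext => x /=; apply: eq_bigr => k _.
by rewrite gvecE (g_vector_equiv (eqX k)).
Qed.

Lemma gfan_relabel (D : {pred iota}) : codom g =i D ->
  forall t : set (kappa -> R), gfan fg t <->
    exists2 s, fan_on R D s & t = (fun v => v \o g) @` s.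
Proof.
move=> gD t; split=> [[T [/presiltingE rigT /basic_cxE basT ->]]|].
  exists (cone R (of_cx T)); last exact: gconeE.
  by exists (of_cx T); split=> // i /labels_of_cx; rewrite gD.
move=> [_ [T [TD rigT basT ->]] ->].
have [|T' T'T] := @of_cx_surj T; first by move=> i /TD; rewrite -gD.
subst T; exists T'.
by split; [apply/presiltingE | apply/basic_cxE | rewrite gconeE].
Qed.

End Relabelling.
End TwoTermComplexes.

Section CoordinateSubspace.
Variables (n : nat) (I : {set 'I_n}) (R : realType).

Lemma codom_subidx : codom (val : subidx I -> 'I_n) =i I.
Proof.
move=> i; apply/codomP/idP => [[x ->]|iI]; first exact: valP.
by exists (exist _ i iI).
Qed.

Lemma embedI_val (v : 'I_n -> R) : K0I I v -> embedI I (v \o val) = v.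
Proof.
move=> vI; apply: boolp.funext => i; rewrite /embedI.
by case: insubP => [x _ <-|/vI ->].
Qed.

Lemma image_embedI_val (s : set ('I_n -> R)) : s `<=` K0I I ->
  embedI I @` ((fun v => v \o val) @` s) = s.
Proof.
move=> sI; rewrite image_comp -[RHS]image_id.
by apply: eq_imagel => v /sI; apply: embedI_val.
Qed.

End CoordinateSubspace.

Theorem theorem4p16 (F : fieldType) (A : falgType F) (n : nat) (e : 'I_n -> A)
  (I : {set 'I_n}) (R : realType) :
  orth_idems e -> complete_idems e -> (forall i, primitive_idem (e i)) ->
  basic_idems e ->
  forall s : set ('I_n -> R),
    (gfan (R:=R) e s /\ s `<=` K0I (R:=R) I) <->
    (exists t, gfan (R:=R) (sub_idems e I) t /\ s = embedI I @` t).
Proof.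
move=> orth _ prim basic s.
have codom_id : codom (@id 'I_n) =i predT by move=> i; apply: codom_f.
have gfan_full t : gfan e t <-> fan_on orth (R := R) predT t.
  have -> := gfan_relabel orth prim basic (@inj_id _) codom_id t.
  split=> [[s' fan_s' ->]|fan_t]; first by rewrite image_id.
  by exists t; rewrite ?image_id.
have gfan_sub := gfan_relabel orth prim basic (R := R) val_inj (codom_subidx I).
have fan_sub := @fan_on_supportedP _ _ _ _ orth prim basic R I.
split=> [[/gfan_full fan_s sI]|[_ [/gfan_sub [s' fan_s' ->] ->]]].
  exists ((fun v => v \o val) @` s); rewrite image_embedI_val //.
  by split=> //; apply/gfan_sub; exists s => //; apply/fan_sub.
have [fan_full s'I] := (fan_sub s').1 fan_s'.
by rewrite image_embedI_val //; split=> //; apply/gfan_full.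
Qed.
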